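(* Let $n\ge 3$ and consider the $n$-stage binary linear feedback shift register with feedback function $F(x_1,\ldots,x_n)=x_{n-1}+x_n$ over $GF(2)$. Then its state diagram $G_F$ has exactly two connected components $G_1$ and $G_2$, where $G_1$ contains the loop at the all-zero state $\mathbf{0}^n=(0,\ldots,0)$ (the cycle $[0]$), and $G_2$ contains the cycle of length $3$ denoted $[0,1,1]$, i.e. the cycle $v_1\to v_2\to v_3\to v_1$ with $v_1=(0,1,1,0,1,1,\ldots)$, $v_2=(1,1,0,1,1,0,\ldots)$, $v_3=(1,0,1,1,0,1,\ldots)$ (the first $n$ terms of the respective periodic sequences).
   Context: An $n$-stage feedback shift register (FSR) with feedback function $F:GF(2)^n\to GF(2)$ maps a state $(a_1,\ldots,a_n)\in GF(2)^n$ to its successor $(a_2,\ldots,a_n,F(a_1,\ldots,a_n))$. Its state diagram $G_F$ is the directed graph on vertex set $GF(2)^n$ with an arc from each state to its successor. Connected components are taken in the underlying undirected graph. A cycle written as a ring sequence $[y_1,\ldots,y_k]$ denotes the cycle of $k$ distinct states $Y_1\to Y_2\to\cdots\to Y_k\to Y_1$ in $G_F$, where $y_i$ is the first coordinate of $Y_i$; $[0]$ is the loop at $\mathbf{0}^n$. *)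

(* Defs.v *)
From HB Require Import structures.
From mathcomp Require Import all_boot all_order all_algebra.

Set Implicit Arguments.
Unset Strict Implicit.
Unset Printing Implicit Defensive.

Import GRing.Theory.
Local Open Scope ring_scope.

(* Coordinates are numbered from 0: a_i is a`_(i - 1). *)
Definition state (n : nat) : finType := n.-tuple 'F_2.

(* (a_1, ..., a_n) |-> (a_2, ..., a_n, F a): the out-of-range default of nth
   is used exactly once, at the last coordinate, where it supplies F a. *)
Definition fsr_succ (n : nat) (F : state n -> 'F_2) (a : state n) : state n :=
  [tuple nth (F a) a i.+1 | i < n].

Definition state_diagram (n : nat) (F : state n -> 'F_2) : rel (state n) :=
  [rel a b | b == fsr_succ F a].

Definition undirected (T : finType) (e : rel T) : rel T :=
  [rel x y | e x y || e y x].

(* A component is represented by its vertex set, the component itself being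
   the subgraph induced on it. *)
Definition components (T : finType) (e : rel T) : {set {set T}} :=
  equivalence_partition (connect (undirected e)) [set: T].

(* The nonempty list c of distinct states is a directed cycle of G_F, and it
   is written [y_1, ..., y_k] as a ring sequence. *)
Definition ring_cycle (n : nat) (F : state n -> 'F_2)
    (y : seq 'F_2) (c : seq (state n)) : Prop :=
  [/\ (0 < size c)%N, ucycle (state_diagram F) c
    & y = [seq (a : seq 'F_2)`_0 | a : state n <- c]].

Definition zero_state (n : nat) : state n := [tuple 0 | i < n].

(* The first n terms of the periodic sequence s s s ... *)
Definition periodic_state (n : nat) (s : seq 'F_2) : state n :=
  [tuple s`_(i %% size s) | i < n].

(* x_{n-1} + x_n, intended for n >= 2. *)
Definition feedback_last_two (n : nat) (x : state n) : 'F_2 :=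
  (x : seq 'F_2)`_(n - 2) + (x : seq 'F_2)`_(n - 1).

(* Main.v *)
(** Let [x], [y] be the last two coordinates of a state [a]. Over GF(2) the
    recurrence turns [x, y] into the 3-periodic sequence
    [x, y, x + y, x, y, x + y, ...], and after [n - 2] steps the initial
    coordinates of [a] have been shifted out, so [a] is connected to the state
    given by this sequence. That state is zero if [x = y = 0], and otherwise lies
    on the cycle [0, 1, 1]. The two cases are not connected, because the
    condition [x = y = 0] holds for a state iff it holds for its successor. *)

Require Import Defs.
From mathcomp Require Import all_boot all_order all_algebra.
From mathcomp Require Import zify.

Set Implicit Arguments.
Unset Strict Implicit.
Unset Printing Implicit Defensive.

Import GRing.Theory.
Local Open Scope ring_scope.

Lemma undirected_connect_sym (T : finType) (e : rel T) :
  connect_sym (undirected e).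
Proof. by apply: sym_connect_sym => x y; exact: orbC. Qed.

(** As [P] is constant along arcs, connected vertices agree on [P]. Conversely, vertices that agree
    on [P] are joined through the representative [u] or [v] of their side. So connectedness is
    exactly equality of [P]-values. *)
Lemma components_pair (T : finType) (e : rel T) (P : pred T) (u v : T) :
    P u -> ~~ P v -> (forall a b, e a b -> P a = P b) ->
    (forall a, connect (undirected e) a (if P a then u else v)) ->
  components e = [set [set x | P x]; [set x | ~~ P x]].
Proof.
move=> Pu nPv Pe Pc.
have closedP : closed (undirected e) P.
  by move=> a b /orP[/Pe|/Pe/esym].
have connP a b : connect (undirected e) a b = (P a == P b).
  apply/idP/eqP => [/(closed_connect closedP) //|Pab].
  apply: connect_trans (Pc a) _.
  by rewrite undirected_connect_sym Pab; apply: Pc.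
have classE a : [set y in [set: T] | connect (undirected e) a y] =
    if P a then [set x | P x] else [set x | ~~ P x].
  by apply/setP=> b; case: ifP => Pa; rewrite !inE connP Pa; case: (P b).
apply/setP=> B; rewrite !inE; apply/imsetP/orP => [[a _ ->]|[]/eqP->].
- by rewrite classE; case: (P a); [left | right].
- by exists u; rewrite ?inE // classE Pu.
- by exists v; rewrite ?inE // classE (negPf nPv).
Qed.

Lemma connect_fsr_succ (n : nat) (F : state n -> 'F_2) (a : state n) :
  connect (undirected (state_diagram F)) a (fsr_succ F a).
Proof. by apply: connect1; apply/orP; left; apply: eqxx. Qed.

Lemma connect_iter_fsr_succ (n : nat) (F : state n -> 'F_2) (k : nat)
    (a : state n) :
  connect (undirected (state_diagram F)) a (iter k (fsr_succ F) a).
Proof.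
elim: k => [|k IHk] /=; first exact: connect0.
exact: connect_trans IHk (connect_fsr_succ _ _).
Qed.

Lemma nth_fsr_succ (n : nat) (F : state n -> 'F_2) (a : state n) (i : nat) :
  (i < n)%N ->
  (fsr_succ F a : seq 'F_2)`_i =
    if i.+1 == n then F a else (a : seq 'F_2)`_i.+1.
Proof.
move=> lt_in; rewrite -[i]/(val (Ordinal lt_in)) -tnth_nth tnth_mktuple /=.
case: eqP => [eq_in|ne_in]; first by rewrite nth_default // size_tuple eq_in.
by apply: set_nth_default; rewrite size_tuple; lia.
Qed.

Lemma nth_periodic_state (n : nat) (s : seq 'F_2) (i : nat) :
  (i < n)%N -> (periodic_state n s : seq 'F_2)`_i = s`_(i %% size s).
Proof.
by move=> lt_in; rewrite -[i]/(val (Ordinal lt_in)) -tnth_nth tnth_mktuple.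
Qed.

Lemma zero_state_periodic (n : nat) :
  zero_state n = periodic_state n [:: 0; 0; 0].
Proof.
apply: eq_from_tnth => i; rewrite !tnth_mktuple /=.
by case: (_ %% 3)%N => [|[|[|]]] //= k; rewrite nth_nil.
Qed.

Lemma F2_cases (x : 'F_2) : x = 0 \/ x = 1.
Proof. by case: x => [[|[|]]] //= lt_x2; [left|right]; apply/val_inj. Qed.

(** In characteristic 2, [y + (x + y) = x] and [(x + y) + x = y], so the recurrence survives the
    wrap-around of the period. *)
Lemma nth_ring3_add (x y : 'F_2) (k : nat) :
  [:: x; y; x + y]`_(k %% 3) + [:: x; y; x + y]`_(k.+1 %% 3) =
  [:: x; y; x + y]`_(k.+2 %% 3).
Proof.
rewrite -(addn2 k) -(addn1 k) -(modnDml k 1) -(modnDml k 2).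
have := ltn_pmod k (isT : 0 < 3)%N.
by case: (k %% 3)%N => [|[|[|]]] //= _;
  case: (F2_cases x) => ->; case: (F2_cases y) => ->; apply/val_inj.
Qed.

Section FeedbackLastTwo.

Variables (n : nat) (n_ge3 : (3 <= n)%N).
Let F := @feedback_last_two n.
Let penult (a : state n) := (a : seq 'F_2)`_(n - 2).
Let last (a : state n) := (a : seq 'F_2)`_(n - 1).
Let last_two_zero (a : state n) := (penult a == 0) && (last a == 0).

(** After [k] steps, coordinate [i] is term [i + k] of the sequence generated from [a]. The second
    bound restricts to terms from the penultimate coordinate of [a] onwards, where the 3-periodic
    pattern starts; hence the offset [n - 2]. *)
Lemma nth_iter_feedback (a : state n) (k i : nat) :
  (i < n)%N -> (n - 2 <= i + k)%N ->
  (iter k (fsr_succ F) a : seq 'F_2)`_i =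
    [:: penult a; last a; penult a + last a]`_((i + k - (n - 2)) %% 3).
Proof.
elim: k i => [|k IHk] i lt_in le_ik.
  (* With no step taken, the bounds leave only the last two coordinates. *)
  have [->|->] : i = (n - 2)%N \/ i = (n - 1)%N by lia.
    by rewrite addn0 subnn.
  by have -> : (n - 1 + 0 - (n - 2) = 1)%N by lia.
rewrite iterS nth_fsr_succ //; case: eqP => [eq_in|ne_in]; last first.
  by rewrite IHk ?addSnnS //; lia.
(* Here [i = n - 1]: the new entry is the sum of the pattern's terms [k] and [k.+1]. *)
rewrite {1}/F /feedback_last_two !IHk; try lia.
have -> : (n - 2 + k - (n - 2) = k)%N by lia.
have -> : (n - 1 + k - (n - 2) = k.+1)%N by lia.
have -> : (i + k.+1 - (n - 2) = k.+2)%N by lia.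
exact: nth_ring3_add.
Qed.

Lemma iter_feedback_periodic (a : state n) :
  iter (n - 2) (fsr_succ F) a =
    periodic_state n [:: penult a; last a; penult a + last a].
Proof.
apply: eq_from_tnth => i; rewrite !(tnth_nth 0) nth_periodic_state //.
by rewrite nth_iter_feedback ?leq_addl // addnK.
Qed.

(** The hypothesis makes the periodic sequence obey the recurrence, so a step of the register shifts
    it by one, which rotates its period. *)
Lemma fsr_succ_periodic (x y z : 'F_2) :
  x + y = z -> fsr_succ F (periodic_state n [:: x; y; z]) =
               periodic_state n [:: y; z; x].
Proof.
move=> <-; apply: eq_from_tnth => i; rewrite !(tnth_nth 0).
have lt_in := ltn_ord i; rewrite nth_fsr_succ // [RHS]nth_periodic_state //.
(* Both sides are term [i.+1] of the unrotated sequence; at the last coordinate this is the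
   recurrence. *)
transitivity [:: x; y; x + y]`_(i.+1 %% 3).
  case: eqP => [eq_in|ne_in]; last by rewrite nth_periodic_state //; lia.
  rewrite /F /feedback_last_two !nth_periodic_state /=; try lia.
  have -> : (n - 1 = (n - 2).+1)%N by lia.
  by rewrite nth_ring3_add; congr nth; lia.
rewrite -(addn1 i) -modnDml /=.
by have := ltn_pmod i (isT : 0 < 3)%N; case: (i %% 3)%N => [|[|[|]]].
Qed.

(** The last two coordinates go from [x, y] to [y, x + y], an invertible linear map, so they vanish
    together before and after. *)
Lemma last_two_zero_succ (a : state n) :
  last_two_zero (fsr_succ F a) = last_two_zero a.
Proof.
rewrite /last_two_zero /penult /last !nth_fsr_succ; try lia.
have -> : ((n - 2).+1 == n) = false by lia.
have -> : ((n - 1).+1 == n) by lia.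
have -> : ((n - 2).+1 = n - 1)%N by lia.
rewrite /F /feedback_last_two andbC.
by case: (eqVneq (a : seq _)`_(n - 1) 0) => [->|]; rewrite ?andbF ?addr0.
Qed.

(** Wherever the state ends within the period, two cyclically adjacent entries of [x, y, x + y] sum
    to the third, so they both vanish only if all three do. *)
Lemma last_two_zero_periodic (x y z : 'F_2) :
  x + y = z ->
  last_two_zero (periodic_state n [:: x; y; z]) = (x == 0) && (y == 0).
Proof.
move=> <-; rewrite /last_two_zero /penult /last !nth_periodic_state; try lia.
have -> : (n - 1 = (n - 2) + 1)%N by lia.
rewrite -(modnDml _ 1) /=.
have := ltn_pmod (n - 2) (isT : 0 < 3)%N.
by case: (_ %% 3)%N => [|[|[|]]] //= _;
  case: (F2_cases x) => ->; case: (F2_cases y) => ->.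
Qed.

End FeedbackLastTwo.

Theorem theorem3 (n : nat) (hn : (3 <= n)%N) :
  exists G1 G2 : {set state n},
    [/\ G1 <> G2,
        components (state_diagram (@feedback_last_two n)) = [set G1; G2],
        ring_cycle (@feedback_last_two n) [:: 0] [:: zero_state n] /\
        zero_state n \in G1
      & let v1 := periodic_state n [:: 0; 1; 1] in
        let v2 := periodic_state n [:: 1; 1; 0] in
        let v3 := periodic_state n [:: 1; 0; 1] in
        ring_cycle (@feedback_last_two n) [:: 0; 1; 1] [:: v1; v2; v3] /\
        [/\ v1 \in G2, v2 \in G2 & v3 \in G2]].
Proof.
pose F := @feedback_last_two n.
pose P (a : state n) :=
  ((a : seq 'F_2)`_(n - 2) == 0) && ((a : seq 'F_2)`_(n - 1) == 0).
pose v1 := periodic_state n [:: 0; 1; 1].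
pose v2 := periodic_state n [:: 1; 1; 0].
pose v3 := periodic_state n [:: 1; 0; 1].
have add11 : 1 + 1 = 0 :> 'F_2 by apply/val_inj.
have P0 : P (zero_state n).
  by rewrite zero_state_periodic /P last_two_zero_periodic ?addr0 ?eqxx.
have nP1 : ~~ P v1 by rewrite /P last_two_zero_periodic ?add0r.
have nP2 : ~~ P v2 by rewrite /P last_two_zero_periodic.
have nP3 : ~~ P v3 by rewrite /P last_two_zero_periodic ?addr0.
have succ0 : fsr_succ F (zero_state n) = zero_state n.
  by rewrite zero_state_periodic fsr_succ_periodic ?addr0.
have succ1 : fsr_succ F v1 = v2 by rewrite fsr_succ_periodic ?add0r.
have succ2 : fsr_succ F v2 = v3 by rewrite fsr_succ_periodic.
have succ3 : fsr_succ F v3 = v1 by rewrite fsr_succ_periodic ?addr0.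
have arc a b : fsr_succ F a = b -> state_diagram F a b by move=> <-; apply: eqxx.
have head_periodic x y z : (periodic_state n [:: x; y; z] : seq 'F_2)`_0 = x.
  by rewrite nth_periodic_state //; lia.
exists [set a | P a], [set a | ~~ P a]; split.
- by move/setP/(_ (zero_state n)); rewrite !inE P0.
- apply: (@components_pair _ _ _ (zero_state n) v1) => // [a b /eqP->|a].
    by rewrite /P last_two_zero_succ.
  apply: connect_trans (connect_iter_fsr_succ _ (n - 2) a) _.
  rewrite iter_feedback_periodic // /P.
  (* The last two coordinates [00], [01], [10], [11] lead to the zero state, [v1], [v3] and [v2]
     respectively; the last two of these are one arc away from [v1]. *)
  case: (F2_cases (a : seq 'F_2)`_(n - 2)) => ->;
    case: (F2_cases (a : seq 'F_2)`_(n - 1)) => -> /=.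
  + by rewrite addr0 -zero_state_periodic.
  + by rewrite add0r connect0.
  + by rewrite addr0 -succ3 connect_fsr_succ.
  + by rewrite add11 undirected_connect_sym -/v2 -succ1 connect_fsr_succ.
- split; last by rewrite inE.
  split=> //; first by rewrite /ucycle /= arc // succ0.
  by rewrite zero_state_periodic /map head_periodic.
- split; last by rewrite !inE.
  split=> //; last by rewrite /map !head_periodic.
  pose head_of (a : state n) := (a : seq 'F_2)`_0.
  have ne12 : v1 != v2.
    by apply/eqP => /(congr1 head_of); rewrite /head_of !head_periodic.
  have ne13 : v1 != v3.
    by apply/eqP => /(congr1 head_of); rewrite /head_of !head_periodic.
  have ne23 : v2 != v3.
    (* Both [v2] and [v3] begin with 1, so first coordinates cannot separate them. If they were
       equal, [v2] would be fixed by the register, and its successor would also be [v1], against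
       [ne12]. *)
    apply/eqP => eq23; move: ne12.
    by rewrite -succ3 -eq23 succ2 -eq23 eqxx.
  rewrite /ucycle /= !arc // !inE.
  by rewrite negb_or ne12 ne13 ne23.
Qed.
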